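(* There exists an integer $N$ such that for every string $w$ there is an integer $k$ with $0\le k\le N$ such that $JHC^{k}(w)$ is a compound of common and transuranic elements (that is, every string decays in at most $N$ days to a compound of common and transuranic elements).
   Context: A string is a non-empty finite word whose letters are positive integers (each integer is a single letter, even if it has several decimal digits). Juxtaposition denotes concatenation, and $a^m$ denotes the letter $a$ repeated $m$ times. Conway's audioactive operator $JHC$: every string is uniquely written as $a_1^{m_1}a_2^{m_2}\cdots a_r^{m_r}$ with $m_i\ge 1$ and $a_i\ne a_{i+1}$ for all $i$; then $JHC(a_1^{m_1}a_2^{m_2}\cdots a_r^{m_r}) := m_1 a_1 m_2 a_2\cdots m_r a_r$ (a string of $2r$ letters). $JHC^k$ is the $k$-th iterate, $JHC^0$ being the identity. Passing from $w$ to $JHC(w)$ takes one day. Splitting: for strings $L,R$, the string $LR$ is said to split as $L.R$ if $JHC^n(LR)=JHC^n(L)\,JHC^n(R)$ for all $n\ge 0$. A string is an atom (or element) if it does not split as $L.R$ with both $L$ and $R$ non-empty. Every string $s$ can be written uniquely as $s=E_1E_2\cdots E_k$ ($k\ge1$) with each $E_i$ an atom and such that $JHC^n(s)=JHC^n(E_1)\cdots JHC^n(E_k)$ for all $n\ge0$; this is the splitting of $s$ into atoms, and $s$ is called a compound of the elements $E_1,\dots,E_k$. A string is a compound of elements from a given set if all the atoms in its splitting belong to that set. Common elements (also called stable elements): the 92 elements of Conway's periodic table. They are exactly the atoms that occur in the splitting of $JHC^n(1)$ for all sufficiently large $n$, where $1$ denotes the one-letter string; for example $22$ (hydrogen), $13$,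 $12$, $11132$ and $13211$ are common elements. Transuranic elements: for every integer $n\ge 4$, the two strings $1311222113321132211221121332211n$ and $31221132221222112112322211n$, where the last letter is the integer $n$ and every other displayed digit is one letter. *)

(* Defs.v *)
From mathcomp Require Import all_boot.

Set Implicit Arguments.
Unset Strict Implicit.
Unset Printing Implicit Defensive.

(* Words are sequences of natural numbers; the strings among them are the
   non-empty ones all of whose letters are positive. *)
Definition is_string (w : seq nat) : bool :=
  (w != [::]) && all (fun a => 0 < a) w.

(* [runs w] lists the pairs (m_i, a_i) such that w = a_1^m_1 ... a_r^m_r with
   m_i >= 1 and a_i <> a_{i+1}; see [runsP]. *)
Fixpoint runs (w : seq nat) : seq (nat * nat) :=
  if w is a :: w' then
    if runs w' is (m, b) :: r then
      if a == b then (m.+1, b) :: r else (1, a) :: (m, b) :: r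
    else [:: (1, a)]
  else [::].

Definition JHC (w : seq nat) : seq nat :=
  flatten [seq [:: p.1; p.2] | p <- runs w].

Definition splits (L R : seq nat) : Prop :=
  forall n, iter n JHC (L ++ R) = iter n JHC L ++ iter n JHC R.

Definition atom (E : seq nat) : Prop :=
  is_string E /\
  (forall L R, is_string L -> is_string R -> E = L ++ R -> ~ splits L R).

(* [s = flatten Es] is the case n = 0 of the last clause. *)
Definition splitting (s : seq nat) (Es : seq (seq nat)) : Prop :=
  [/\ Es != [::], forall E, E \in Es -> atom E &
      forall n, iter n JHC s = flatten [seq iter n JHC E | E <- Es]].

(* The splitting of a string exists and is unique, so "its splitting has all
   its atoms in P" may be stated existentially. *)
Definition compound (P : seq nat -> Prop) (s : seq nat) : Prop :=
  exists Es, splitting s Es /\ (forall E, E \in Es -> P E).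

Fixpoint decimal_digits (d : Decimal.uint) : seq nat :=
  match d with
  | Decimal.Nil => [::]
  | Decimal.D0 d' => 0 :: decimal_digits d'
  | Decimal.D1 d' => 1 :: decimal_digits d'
  | Decimal.D2 d' => 2 :: decimal_digits d'
  | Decimal.D3 d' => 3 :: decimal_digits d'
  | Decimal.D4 d' => 4 :: decimal_digits d'
  | Decimal.D5 d' => 5 :: decimal_digits d'
  | Decimal.D6 d' => 6 :: decimal_digits d'
  | Decimal.D7 d' => 7 :: decimal_digits d'
  | Decimal.D8 d' => 8 :: decimal_digits d'
  | Decimal.D9 d' => 9 :: decimal_digits d'
  end.

(* [letters 132] is [:: 1; 3; 2]. *)
Definition letters (d : Number.uint) : seq nat :=
  if d is Number.UIntDecimal d' then decimal_digits d' else [::].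
Arguments letters d%_dec_uint_scope.

(* Conway's periodic table, in order of atomic number. *)
Definition common_elements : seq (seq nat) :=
  [:: letters 22; (* H *)
      letters 13112221133211322112211213322112; (* He *)
      letters 312211322212221121123222112; (* Li *)
      letters 111312211312113221133211322112211213322112; (* Be *)
      letters 1321132122211322212221121123222112; (* B *)
      letters 3113112211322112211213322112; (* C *)
      letters 111312212221121123222112; (* N *)
      letters 132112211213322112; (* O *)
      letters 31121123222112; (* F *)
      letters 111213322112; (* Ne *)
      letters 123222112; (* Na *)
      letters 3113322112; (* Mg *)
      letters 1113222112; (* Al *)
      letters 1322112; (* Si *)
      letters 311311222112; (* P *)
      letters 1113122112; (* S *)
      letters 132112; (* Cl *)
      letters 3112; (* Ar *)
      letters 1112; (* K *)
      letters 12; (* Ca *)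
      letters 3113112221133112; (* Sc *)
      letters 11131221131112; (* Ti *)
      letters 13211312; (* V *)
      letters 31132; (* Cr *)
      letters 111311222112; (* Mn *)
      letters 13122112; (* Fe *)
      letters 32112; (* Co *)
      letters 11133112; (* Ni *)
      letters 131112; (* Cu *)
      letters 312; (* Zn *)
      letters 13221133122211332; (* Ga *)
      letters 31131122211311122113222; (* Ge *)
      letters 11131221131211322113322112; (* As *)
      letters 13211321222113222112; (* Se *)
      letters 3113112211322112; (* Br *)
      letters 11131221222112; (* Kr *)
      letters 1321122112; (* Rb *)
      letters 3112112; (* Sr *)
      letters 1112133; (* Y *)
      letters 12322211331222113112211; (* Zr *)
      letters 1113122113322113111221131221; (* Nb *)
      letters 13211322211312113211; (* Mo *)
      letters 311322113212221; (* Tc *)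
      letters 132211331222113112211; (* Ru *)
      letters 311311222113111221131221; (* Rh *)
      letters 111312211312113211; (* Pd *)
      letters 132113212221; (* Ag *)
      letters 3113112211; (* Cd *)
      letters 11131221; (* In *)
      letters 13211; (* Sn *)
      letters 3112221; (* Sb *)
      letters 1322113312211; (* Te *)
      letters 311311222113111221; (* I *)
      letters 11131221131211; (* Xe *)
      letters 13211321; (* Cs *)
      letters 311311; (* Ba *)
      letters 11131; (* La *)
      letters 1321133112; (* Ce *)
      letters 31131112; (* Pr *)
      letters 111312; (* Nd *)
      letters 132; (* Pm *)
      letters 311332; (* Sm *)
      letters 1113222; (* Eu *)
      letters 13221133112; (* Gd *)
      letters 3113112221131112; (* Tb *)
      letters 111312211312; (* Dy *)
      letters 1321132; (* Ho *)
      letters 311311222; (* Er *)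
      letters 11131221133112; (* Tm *)
      letters 1321131112; (* Yb *)
      letters 311312; (* Lu *)
      letters 11132; (* Hf *)
      letters 13112221133211322112211213322113; (* Ta *)
      letters 312211322212221121123222113; (* W *)
      letters 111312211312113221133211322112211213322113; (* Re *)
      letters 1321132122211322212221121123222113; (* Os *)
      letters 3113112211322112211213322113; (* Ir *)
      letters 111312212221121123222113; (* Pt *)
      letters 132112211213322113; (* Au *)
      letters 31121123222113; (* Hg *)
      letters 111213322113; (* Tl *)
      letters 123222113; (* Pb *)
      letters 3113322113; (* Bi *)
      letters 1113222113; (* Po *)
      letters 1322113; (* At *)
      letters 311311222113; (* Rn *)
      letters 1113122113; (* Fr *)
      letters 132113; (* Ra *)
      letters 3113; (* Ac *)
      letters 1113; (* Th *)
      letters 13; (* Pa *)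
      letters 3  (* U *) ].

Definition common (E : seq nat) : Prop := E \in common_elements.

Definition transuranic (E : seq nat) : Prop :=
  exists2 n, 4 <= n &
    E = rcons (letters 1311222113321132211221121332211) n \/
    E = rcons (letters 31221132221222112112322211) n.

Lemma runsP (w : seq nat) (r : seq (nat * nat)) :
  r = runs w <->
  [/\ w = flatten [seq nseq p.1 p.2 | p <- r],
      all (fun p => 0 < p.1) r &
      sorted (fun p q => p.2 != q.2) r].
Proof.
split=> [->|[-> {w}]].
  elim: w => [|a w [eqw posr srt]] //=.
  case: (runs w) eqw posr srt => [|[m b] r'] /= eqw; first by rewrite eqw.
  move=> /andP[m0 posr] srt; case: (a =P b) => [->|/eqP neq] /=.
    by split; [rewrite eqw | | case: (r') srt].
  by split; [rewrite eqw | rewrite m0 | rewrite neq].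
elim: r => [|[m b] r IH] //= /andP[m0 posr] srt.
have eqr := IH posr (path_sorted srt); rewrite {1}eqr.
rewrite {1}eqr /= in srt.
have {}srt : if runs (flatten [seq nseq p.1 p.2 | p <- r]) is (_, c) :: _
             then b != c else true.
  by case: (runs _) srt => [|[k c] r'] //= /andP[].
case: m m0 => // m _; elim: m => [|m /= IHm] /=; last by rewrite -IHm eqxx.
by case: (runs _) srt => [|[k c] r'] // /negbTE ->.
Qed.

(* Main.v *)
Require Import Defs.
From mathcomp Require Import all_boot.

Set Implicit Arguments.
Unset Strict Implicit.
Unset Printing Implicit Defensive.

(** This is Conway's cosmological theorem, with a number of days that is not
    meant to be optimal. All words are read from right to left, the direction
    in which [runs] recurses.

    Splitting. A letter that ends a word ends all its descendants, so L.R
    splits if and only if no descendant of R begins with the last letter of L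
    ([splitsP]). The shape of the first six letters of R often suffices to know
    which letters can ever come first ([cut_heads]); cutting a word wherever
    this is so yields [pieces], which evolve independently
    ([iter_JHC_pieces]).

    Large letters. No run in the image of JHC is longer than 3, so from the
    second day on each letter above 3 ends the word or is followed by a run
    length, at most 3, and the word splits after it ([ohead_iter_JHC], [isolated_large_decays]).
    There remain words over 1, 2, 3 that may end with one large letter, and the
    value of that letter is irrelevant, so that it may be taken to be 4
    ([JHC_relabel]).

    Finiteness. These words are arbitrarily long. For each day k a length l and
    a finite set of words of length at most l are found such that every suffix
    of every piece of day k has its first l letters in this set
    ([admissible]). Such a bound passes from one day to the next: while a piece
    s is read from right to left, the first l letters of the suffix read so far
    and the first l' letters of the piece of JHC s under construction form a
    pair that ranges over a finite set; that this set is closed under reading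
    one more run is a finite verification ([transfer]). Since splitting becomes
    denser every day, the sets remain small while l grows, and in the end every
    word of the set is shorter than l: only finitely many pieces are left, and
    each of them is followed until it has become a compound of elements
    ([chain_windows]).

    Atoms. For each way of cutting an element in two, some descendant of the
    right part begins with the last letter of the left part, within 8 days
    ([atomP]). *)

(** * Runs and the audioactive operator *)

Lemma ohead_runs w : omap snd (ohead (runs w)) = ohead w.
Proof.
case: w => [|a w] //=; case: (runs w) => [|[m b] r] //=.
by case: eqP => [->|].
Qed.

Lemma runs_cons (x : nat) (w : seq nat) :
  ohead w != Some x -> runs (x :: w) = (1, x) :: runs w.
Proof.
move=> /=; rewrite -ohead_runs; case: (runs w) => [|[m b] r] //= nbx.
by case: (x =P b) nbx => [->|//]; rewrite eqxx.
Qed.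

Lemma runs_nseq (m a : nat) (s : seq nat) :
  ohead s != Some a -> runs (nseq m.+1 a ++ s) = (m.+1, a) :: runs s.
Proof.
move=> nsa; elim: m => [|m IHm]; first exact: runs_cons.
by move: IHm; rewrite /= => ->; rewrite eqxx.
Qed.

Lemma JHC_nseq (m a : nat) (s : seq nat) :
  ohead s != Some a -> JHC (nseq m.+1 a ++ s) = [:: m.+1, a & JHC s].
Proof. by move=> nsa; rewrite /JHC runs_nseq. Qed.

Lemma JHC_cons (x : nat) (w : seq nat) :
  ohead w != Some x -> JHC (x :: w) = [:: 1, x & JHC w].
Proof. exact: (@JHC_nseq 0). Qed.

Variant first_run_spec : seq nat -> Prop :=
| NoRun : first_run_spec [::]
| FirstRun (m a : nat) (s : seq nat) of ohead s != Some a :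
    first_run_spec (nseq m.+1 a ++ s).

Lemma first_runP w : first_run_spec w.
Proof.
elim: w => [|x w IHw]; first exact: NoRun.
case: IHw => [|m a s nsa]; first exact: (@FirstRun 0 x [::]).
have [->|nxa] := eqVneq x a; first exact: (@FirstRun m.+1 a s).
by apply: (@FirstRun 0 x (nseq m.+1 a ++ s)); apply: contraNneq nxa => -[->].
Qed.

Lemma runs_ind (P : seq nat -> Prop) :
  P [::] ->
  (forall (m a : nat) (s : seq nat), ohead s != Some a -> P s -> P (nseq m.+1 a ++ s)) ->
  forall w, P w.
Proof.
move=> P0 PS w; have [k] := ubnP (size w); elim: k w => // k IHk w.
case: (first_runP w) => // m a s nsa; rewrite size_cat size_nseq ltnS => le_k.
by apply: PS (IHk _ _) => //; apply: leq_trans le_k; rewrite addSn ltnS leq_addl.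
Qed.

Lemma JHC_eq0 w : (JHC w == [::]) = (w == [::]).
Proof. by case: (first_runP w) => // m a s /JHC_nseq->. Qed.

Lemma iter_JHC_eq0 n w : (iter n JHC w == [::]) = (w == [::]).
Proof. by elim: n => //= n IHn; rewrite JHC_eq0. Qed.

Lemma iter_JHC_nil n : iter n JHC [::] = [::].
Proof. by apply/eqP; rewrite iter_JHC_eq0. Qed.

Lemma last_JHC w : last 0 (JHC w) = last 0 w.
Proof.
elim/runs_ind: w => // m a s nsa IHs; rewrite JHC_nseq // last_cat /=.
have ->: last a (nseq m a) = a by elim: m {nsa}.
case: s nsa IHs => [|x s] //= nsa.
case: (JHC _) (JHC_eq0 (x :: s)) => //=.
Qed.

Lemma last_iter_JHC n w : last 0 (iter n JHC w) = last 0 w.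
Proof. by elim: n => //= n IHn; rewrite last_JHC. Qed.

Lemma is_string_JHC w : is_string w -> is_string (JHC w).
Proof.
rewrite /is_string JHC_eq0 => /andP[-> /=].
elim/runs_ind: w => // m a s nsa IHs; rewrite all_cat JHC_nseq //= => /andP[/andP[-> _]].
exact: IHs.
Qed.

(** * Splitting *)

(** Runs merge across the junction only if the junction letters agree. *)
Lemma JHC_cat (L R : seq nat) :
  L != [::] -> ohead R != Some (last 0 L) -> JHC (L ++ R) = JHC L ++ JHC R.
Proof.
elim/runs_ind: L => // m a s nsa IHs _; rewrite last_cat /=.
have ->: last a (nseq m a) = a by elim: m {nsa}.
move=> nR; rewrite -catA !JHC_nseq //=; last by case: s nsa nR {IHs}.
by congr [:: _, _ & _]; case: s nsa nR IHs => [|x s] //= _ nR ->.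
Qed.

Lemma size_runs (x : nat) (w : seq nat) :
  size (runs (x :: w)) = (ohead w != Some x) + size (runs w).
Proof.
rewrite -ohead_runs /=; case: (runs w) => [|[m b] r] //=.
rewrite (_ : (Some b == Some x) = (x == b)); first by case: (x == b).
by rewrite eq_sym; apply/eqP/eqP => [[]|->].
Qed.

Lemma size_JHC w : size (JHC w) = (size (runs w)).*2.
Proof. by rewrite /JHC; elim: (runs w) => //= p r ->. Qed.

(** If the junction letters agree, a run is lost; this detects a failure to
    split by a mere count of letters. *)
Lemma size_runs_merge (L R : seq nat) :
    L != [::] -> ohead R = Some (last 0 L) ->
  (size (runs (L ++ R))).+1 = size (runs L) + size (runs R).
Proof.
elim: L => // x [|y L] IHL _ hR.
  by rewrite cat1s size_runs hR eqxx /= add0n add1n.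
have {}IHL := IHL isT hR.
by rewrite cat_cons size_runs -addnS IHL (size_runs x (y :: L)) addnA.
Qed.

(** A letter that ends a word keeps ending its descendants, so two consecutive
    parts interact exactly when this letter comes first in a descendant of the
    right part. *)
Lemma splitsP L R : L != [::] -> R != [::] ->
  splits L R <-> forall n, ohead (iter n JHC R) != Some (last 0 L).
Proof.
move=> L0 R0; split=> [spLR n|heads]; last first.
  elim=> [//|n IHn]; rewrite !iterS IHn JHC_cat ?iter_JHC_eq0 //.
  by rewrite last_iter_JHC.
have := spLR n.+1; rewrite !iterS (spLR n) -(last_iter_JHC n L).
set A := iter n JHC L; set B := iter n JHC R => eqAB.
apply/eqP => hB; have := @size_runs_merge A B _ hB.
rewrite iter_JHC_eq0 => /(_ L0); have := congr1 size eqAB.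
rewrite size_cat !size_JHC -doubleD => /double_inj ->.
by move/eqP; rewrite eqn_leq ltnn.
Qed.

Lemma splits_nil L : splits L [::].
Proof. by move=> n; rewrite iter_JHC_nil !cats0. Qed.

Lemma splits_cons x L R : L != [::] -> splits L R -> splits (x :: L) R.
Proof.
case: R => [|y R] L0; first by move=> _; apply: splits_nil.
by move/splitsP => /(_ L0 isT) heads; apply/splitsP => //; case: L L0 heads.
Qed.

(** * Cutting a word into pieces *)

(** In Conway's notation, w begins with 1^1 X^1, with 1^3, or with 3^1 X^k
    where k differs from 3 (X may be missing in the last case). These three
    shapes are exchanged by JHC, hence no descendant begins with 2. *)
Definition odd_start (w : seq nat) : bool :=
  match w with
  | 1 :: v =>
    match v with
    | [::] => false
    | [:: b] => b != 1
    | b :: c :: u => if b == 1 then (c == 1) && (ohead u != Some 1) else b != c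
    end
  | 3 :: v =>
    match v with
    | b :: c :: d :: _ => (b != 3) && ~~ ((b == c) && (c == d))
    | _ => ohead v != Some 3
    end
  | _ => false
  end.

(** The word 22 is a fixed point of JHC, and remains the beginning of all
    descendants when what follows it never begins with 2: nothing, a letter
    above 3, or a word as in [odd_start]. *)
Definition even_start (w : seq nat) : bool :=
  match w with
  | 2 :: 2 :: v =>
    match v with
    | [::] => true
    | [:: n] => (3 < n) || odd_start v
    | _ => odd_start v
    end
  | _ => false
  end.

Definition cut (x : nat) (w : seq nat) : bool :=
  if x == 2 then odd_start w else even_start w.

Lemma odd_start_head w : odd_start w -> (ohead w == Some 1) || (ohead w == Some 3).
Proof. by case: w => [|[|[|[|[|a]]]] w]. Qed.

Lemma even_start_head w : even_start w -> ohead w = Some 2.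
Proof. by case: w => [|[|[|[|a]]] w]. Qed.

Lemma odd_start_JHC w : odd_start w -> odd_start (JHC w).
Proof.
case: w => [|[|[|[|[|a]]]] v] //; last first.
  case: v => [|b v] // ow.
  have nb3 : b != 3 by case: v ow => [|c [|d v]] //= /andP[].
  rewrite JHC_cons //.
  (* the image is 1 3 m b ... where m is the length of the run of b *)
  suff: ohead (JHC (b :: v)) != Some 3.
    by case: (JHC (b :: v)) => [|m [|d u]] //= nm3; rewrite eq_sym;
      apply: contraNneq nm3 => ->.
  case: (first_runP (b :: v)) ow => [|m a s nsa ow] //; rewrite JHC_nseq //.
  case: m ow => [|[|[|m]]] ow //.
  by move: ow; rewrite /= !eqxx andbF.
case: v => [|b [|c u]] //=.
  by move=> nb1; rewrite JHC_cons //; apply: contra nb1 => /eqP[->].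
case: eqP => [-> /andP[/eqP-> nu1]|/eqP nb1 nbc].
  rewrite (@JHC_nseq 2 1 u) //=.
  case: (first_runP u) nu1 => [|m a s nsa na1] //; rewrite JHC_nseq //=.
  by rewrite andbC; apply/negP => /andP[/eqP eqma /eqP eqm1]; rewrite -eqma -eqm1 in na1.
rewrite JHC_cons /=; last by apply: contra nb1 => /eqP[->].
rewrite (JHC_cons (x := b)) /=; last by apply: contra nbc => /eqP[->].
by apply: contra nb1 => /eqP[->].
Qed.

Lemma even_start_JHC w : even_start w -> even_start (JHC w).
Proof.
case: w => [|[|[|[|a]]] [|[|[|[|b]]] v]] //.
have step u : odd_start u -> even_start (JHC [:: 2, 2 & u]).
  move=> ou; rewrite (@JHC_nseq 1 2 u); last first.
    by have := odd_start_head ou; case: (ohead u) => // -[|[|[|]]].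
  have := odd_start_JHC ou.
  by case: (JHC u) => [|c [|d r]] //= ->; rewrite ?orbT.
case: v => [|n [|c v]]; [by move=> _; apply: isT| | exact: step].
case/orP=> [lt3n|]; last exact: step.
rewrite (@JHC_nseq 1 2 [:: n]) //=; last by case: n lt3n => [|[|[|]]].
by case: n lt3n => [|[|]].
Qed.

Lemma iter_odd_start n w : odd_start w -> odd_start (iter n JHC w).
Proof. by move=> ow; elim: n => //= n; apply: odd_start_JHC. Qed.

Lemma iter_even_start n w : even_start w -> even_start (iter n JHC w).
Proof. by move=> ew; elim: n => //= n; apply: even_start_JHC. Qed.

(** With [splitsP], this is the sufficient half of Conway's splitting
    theorem. *)
Lemma cut_heads x w n : cut x w -> ohead (iter n JHC w) != Some x.
Proof.
rewrite /cut; case: eqP => [-> /(iter_odd_start n)/odd_start_head|].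
  by case: (ohead _) => // -[|[|[|[|]]]].
by move/eqP=> nx2 /(iter_even_start n)/even_start_head->; apply: contra nx2 => /eqP[->].
Qed.

(** The head of the list is the piece under construction. Whether it is cut off
    from the next letter depends on this piece alone, because what follows it
    does not affect the first letters of its descendants. *)
Definition pieces (w : seq nat) : seq (seq nat) :=
  foldr (fun x ps =>
           if cut x (head [::] ps) then [:: x] :: ps
           else (x :: head [::] ps) :: behead ps) [::] w.

Lemma cut_nil x : cut x [::] = false.
Proof. by rewrite /cut; case: eqP. Qed.

Lemma pieces_neq0 w p : p \in pieces w -> p != [::].
Proof.
elim: w p => //= x w IHw p; case: ifP => _; rewrite inE => /predU1P[->//|].
  exact: IHw.
by case: (pieces w) IHw => //= q ps IHw pps; apply: IHw; rewrite inE pps orbT.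
Qed.

(** The second clause is what keeps the induction going: it transports the
    first letters of the descendants of the leading piece to the whole word,
    and it survives the addition of letters to that piece. *)
Lemma pieces_invariant w :
  (forall n, iter n JHC w = flatten [seq iter n JHC p | p <- pieces w]) /\
  splits (head [::] (pieces w)) (flatten (behead (pieces w))).
Proof.
elim: w => [|x w [IHw spw]] /=.
  by split=> [n|]; [exact: iter_JHC_nil | exact: splits_nil].
have neq0 := @pieces_neq0 w; have defw := IHw 0; rewrite /= map_id in defw.
case: ifP => [xw | _] /=.
  have w0 : w != [::] by apply: contraTneq xw => ->; rewrite cut_nil.
  have sp : splits [:: x] w.
    apply/splitsP => // n; case: (pieces w) defw neq0 spw xw => [|p ps] //= defw neq0 spw xp.
      by rewrite defw in w0.
    rewrite defw spw; have := cut_heads n xp.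
    have: iter n JHC p != [::] by rewrite iter_JHC_eq0 neq0 ?mem_head.
    by case: (iter n JHC p).
  by split=> [n|]; rewrite -?defw // -IHw -sp.
case: (pieces w) IHw spw neq0 defw => [|p ps] /= IHw spw neq0 defw.
  by split=> [n|]; [rewrite defw cats0 | exact: splits_nil].
have p0 : p != [::] by rewrite neq0 ?mem_head.
have sp := splits_cons x p0 spw; split=> // n.
rewrite defw -cat_cons sp; congr (_ ++ _).
have := IHw n; rewrite defw spw => /eqP.
by rewrite eqseq_cat // => /andP[_ /eqP].
Qed.

Lemma iter_JHC_pieces n w :
  iter n JHC w = flatten [seq iter n JHC p | p <- pieces w].
Proof. by case: (pieces_invariant w). Qed.

(** * Decay *)

(** After n days, w is a concatenation of words of P that evolve
    independently. *)
Definition decays (P : seq nat -> Prop) (n : nat) (w : seq nat) : Prop :=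
  exists Es, (forall E, E \in Es -> P E) /\
    forall i, iter (n + i) JHC w = flatten [seq iter i JHC E | E <- Es].

Lemma decays_parts P n w ps :
    (forall i, iter i JHC w = flatten [seq iter i JHC p | p <- ps]) ->
    (forall p, p \in ps -> decays P n p) ->
  decays P n w.
Proof.
move=> parts dec; suff [Es [PEs eqEs]] : exists Es, (forall E, E \in Es -> P E) /\
    forall i, flatten [seq iter (n + i) JHC p | p <- ps]
              = flatten [seq iter i JHC E | E <- Es].
  by exists Es; split=> // i; rewrite parts eqEs.
elim: ps dec {parts} => [|p ps IHps] dec; first by exists [::].
have [Es [PEs eqEs]] := IHps (fun q qps => dec q (mem_behead (s := p :: ps) qps)).
have [Ds [PDs eqDs]] := dec p (mem_head p ps).
exists (Ds ++ Es); split=> [E|i]; last by rewrite map_cat flatten_cat /= eqDs eqEs.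
by rewrite mem_cat => /orP[/PDs|/PEs].
Qed.

Lemma decaysS P n w :
  (forall p, p \in pieces (JHC w) -> decays P n p) -> decays P n.+1 w.
Proof.
move/(decays_parts (fun i => iter_JHC_pieces i (JHC w))) => [Es [PEs eqEs]].
by exists Es; split=> // i; rewrite addSn iterSr.
Qed.

Lemma decays_splits P n L R :
  splits L R -> decays P n L -> decays P n R -> decays P n (L ++ R).
Proof.
move=> spLR decL decR; apply: (@decays_parts P n _ [:: L; R]) => [i|p].
  by rewrite /= cats0.
by rewrite !inE => /orP[]/eqP->.
Qed.

(** * Words without four equal consecutive letters *)

Fixpoint short_runs (w : seq nat) : bool :=
  if w is a :: v then
    (if v is [:: b, c, d & _] then ~~ [&& a == b, b == c & c == d] else true)
    && short_runs v
  else true.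

Lemma short_runs_suffix u v : short_runs (u ++ v) -> short_runs v.
Proof. by elim: u => //= a u IHu /andP[_ /IHu]. Qed.

Lemma short_runs_prefix u v : short_runs (u ++ v) -> short_runs u.
Proof.
elim: u => //= a u IHu /andP[sra /IHu->]; rewrite andbT.
by case: u sra {IHu} => [|b [|c [|d u]]].
Qed.

Lemma short_runs_nseq m a s : short_runs (nseq m.+1 a ++ s) -> m < 3.
Proof. by case: m => [|[|[|m]]] //=; rewrite !eqxx. Qed.

Lemma short_runs_rcons u x :
  all (fun y => y < x) u -> short_runs u -> short_runs (rcons u x).
Proof.
elim: u => //= a u IHu /andP[_ ltux] /andP[sra sru]; rewrite IHu // andbT.
case: u sra ltux {IHu sru} => [|b [|c [|d u]]] //= _.
by rewrite andbT => /andP[_ /ltn_eqF->]; rewrite !andbF.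
Qed.

(** Four consecutive letters of an image include, at distance two, the letters
    of two consecutive runs, which differ. *)
Lemma short_runs_JHC w : short_runs (JHC w).
Proof.
elim/runs_ind: w => // m a s nsa; rewrite (JHC_nseq _ nsa).
case: (first_runP s) nsa => [|k b t ntb] // nba; rewrite (JHC_nseq _ ntb) => IHs.
have {}nba : a == b = false by apply: contraNF nba => /eqP->.
have nab (c : nat) : (a == c) && (c == b) = false.
  by apply: contraFF nba => /andP[/eqP-> /eqP->].
case: (JHC t) IHs => [|c r] /=; first by rewrite nab andbF.
by move=> ->; rewrite nab andbF (andbA (a == _)) nab.
Qed.

Definition small (w : seq nat) : bool :=
  all (fun x => 0 < x <= 4) w && short_runs w.

Lemma small_JHC w : small w -> small (JHC w).
Proof.
rewrite /small short_runs_JHC andbT.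
elim/runs_ind: w => // m a s nsa IHs /andP[]; rewrite all_cat => /andP[aP sP] sr.
rewrite JHC_nseq //= IHs ?sP ?(short_runs_suffix sr) // andbT.
by rewrite (ltn_trans (short_runs_nseq sr)) //=; case/andP: aP => /= ->.
Qed.

Lemma small_iter_JHC n w : small w -> small (iter n JHC w).
Proof. by move=> sw; elim: n => //= n; apply: small_JHC. Qed.

(** No run length reaches 4 in the evolution of a [small] word, so that the
    letter 4 is inert there and stands for any larger letter. *)
Definition relabel (n x : nat) : nat := if x == 4 then n else x.

Lemma relabel_inj n x y :
  3 < n -> x <= 4 -> y <= 4 -> relabel n x = relabel n y -> x = y.
Proof.
rewrite /relabel => lt3n le4x le4y.
case: eqP => [->|/eqP x4]; case: eqP => [-> //|/eqP y4] // def_n.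
  by move: lt3n; rewrite def_n ltn_neqAle eq_sym in y4 *; move: y4 le4y; case: (y) => [|[|[|[|[]]]]].
by move: lt3n x4 le4x; rewrite -def_n; case: (x) => [|[|[|[|[]]]]].
Qed.

Lemma JHC_relabel n w :
  3 < n -> small w -> JHC (map (relabel n) w) = map (relabel n) (JHC w).
Proof.
move=> lt3n; elim/runs_ind: w => // m a s nsa IHs /andP[]; rewrite all_cat.
move=> /andP[/andP[/andP[_ le4a] _] sP] sr; have lt3m := short_runs_nseq sr.
have ss : small s by rewrite /small sP (short_runs_suffix sr).
rewrite map_cat map_nseq !JHC_nseq //= ?IHs //.
  by rewrite /relabel (ltn_eqF (lt3m : m.+1 < 4)).
case: s nsa sP {IHs ss sr} => [|b s] //= nba /andP[/andP[_ le4b] _].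
by apply: contra nba => /eqP[/(relabel_inj lt3n le4b le4a)->].
Qed.

Lemma iter_JHC_relabel i n w : 3 < n -> small w ->
  iter i JHC (map (relabel n) w) = map (relabel n) (iter i JHC w).
Proof.
by move=> lt3n sw; elim: i => //= i ->; rewrite JHC_relabel ?small_iter_JHC.
Qed.

(** * Local languages *)

(** A language bounded by windows: [S] constrains the first l letters of every
    suffix, [F] those of the whole word. *)
Fixpoint locally (l : nat) (S : pred (seq nat)) (s : seq nat) : bool :=
  S (take l s) && (if s is _ :: s' then locally l S s' else true).

Definition admissible (l : nat) (S F : pred (seq nat)) (s : seq nat) : bool :=
  locally l S s && F (take l s).

Lemma locally_suffix l S u v : locally l S (u ++ v) -> locally l S v.
Proof. by elim: u => //= a u IHu /andP[_ /IHu]. Qed.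

Lemma locally_take l S s : locally l S s -> S (take l s).
Proof. by case: s => [|a s] /andP[]. Qed.

Lemma take_cons_take l x (s : seq nat) : take l (x :: take l s) = take l (x :: s).
Proof. by case: l => //= l; rewrite take_takel. Qed.

(** The longest pattern inspected by [cut] is 2 2 3 followed by three
    letters. *)
Lemma cut_take l x w : 5 < l -> cut x (take l w) = cut x w.
Proof.
case: l => [|[|[|[|[|[|l]]]]]] // _; rewrite /cut.
by case: w => [|[|[|[|[|a]]]] [|[|[|[|b]]] [|c [|d [|e [|f w]]]]]].
Qed.

(** The effect of one more letter on the window of the leading piece. *)
Definition grow (l x : nat) (w : seq nat) : seq nat :=
  if cut x w then [:: x] else take l (x :: w).

Section Transfer.

Variables (l l' : nat) (S F S' F' : pred (seq nat)) (P : rel (seq nat)).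
(* [P q w] is meant to hold when q is the window of a suffix of a word of the
   source language that starts at the boundary of a run, and w the window of
   the leading piece of the image of this suffix. A run a^(m+1) in front of the
   suffix puts a, then m+1, in front of the image. *)
Hypothesis lt5l' : 5 < l'.
Hypothesis P_nil : P [::] [::].
Hypothesis S'_nil : S' [::].
Hypothesis P_run : forall (s w : seq nat) (m a : nat),
    P (take l s) w -> ohead s != Some a -> locally l S (nseq m.+1 a ++ s) ->
  let w1 := grow l' a w in let w2 := grow l' m.+1 w1 in
  [/\ cut a w -> F' w, S' w1, cut m.+1 w1 -> F' w1, S' w2
    & P (take l (nseq m.+1 a ++ s)) w2].
Hypothesis P_end : forall q w, P q w -> F q -> F' w.

(* All pieces but the leading one are finished, hence subject to F'. *)
Let tracked (w : seq nat) (ps : seq (seq nat)) :=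
  [/\ take l' (head [::] ps) = w, locally l' S' (head [::] ps)
    & all (admissible l' S' F') (behead ps)].

Lemma tracked_cons x v w :
    tracked w (pieces v) -> (cut x w -> F' w) -> S' (grow l' x w) ->
  tracked (grow l' x w) (pieces (x :: v)).
Proof.
case=> defw locp adm F'w S'g; rewrite /tracked /grow /= -(cut_take x _ lt5l') defw.
move: S'g F'w; rewrite /grow; case: ifP => [xw S'x /(_ isT) F'w | nxw S'xw _].
  have l'x : take l' [:: x] = [:: x] by case: l' lt5l'.
  split=> //=; first by rewrite l'x S'x; case: l'; rewrite /= S'_nil.
  case: (pieces v) defw locp adm => [|p ps] /= defw locp adm.
    by rewrite -defw cut_nil in xw.
  by rewrite /admissible locp defw F'w.
by rewrite /= -take_cons_take defw; split=> //;
  rewrite -defw take_cons_take -take_cons_take defw S'xw.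
Qed.

Lemma tracked_pieces s :
  locally l S s -> exists2 w, P (take l s) w & tracked w (pieces (JHC s)).
Proof.
elim/runs_ind: s => [_|m a s nsa IHs locs].
  by exists [::] => //; split=> //=; case: l'; rewrite /= S'_nil.
have [w Pw trw] := IHs (locally_suffix locs).
have /= [F'w S'1 F'1 S'2 P2] := P_run Pw nsa locs.
by rewrite JHC_nseq //; eexists; [exact: P2 | do 2!apply: tracked_cons => //].
Qed.

(** A finite relation closed under reading one run carries a window bound from
    a language to the pieces of its image. *)
Lemma transfer s p :
  admissible l S F s -> p \in pieces (JHC s) -> admissible l' S' F' p.
Proof.
case/andP=> /tracked_pieces[w Pw [defw locp /allP adm]] Fs.
case: (pieces _) defw locp adm => //= q ps defw locq adm.
rewrite inE => /predU1P[->|/adm //].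
by rewrite /admissible locq defw (P_end Pw Fs).
Qed.

End Transfer.

(** * Tries of words over the letters 1, 2, 3, 4 *)

Inductive trie (A : Type) : Type :=
| Leaf
| Node of option A & trie A & trie A & trie A & trie A.
Arguments Leaf {A}.

Fixpoint find (A : Type) (t : trie A) (w : seq nat) : option A :=
  if t is Node v t1 t2 t3 t4 then
    match w with
    | [::] => v
    | 1 :: w' => find t1 w'
    | 2 :: w' => find t2 w'
    | 3 :: w' => find t3 w'
    | 4 :: w' => find t4 w'
    | _ => None
    end
  else None.

Fixpoint alter (A : Type) (f : option A -> A) (t : trie A) (w : seq nat) : trie A :=
  let: (v, t1, t2, t3, t4) :=
    if t is Node v t1 t2 t3 t4 then (v, t1, t2, t3, t4)
    else (None, Leaf, Leaf, Leaf, Leaf) in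
  match w with
  | [::] => Node (Some (f v)) t1 t2 t3 t4
  | 1 :: w' => Node v (alter f t1 w') t2 t3 t4
  | 2 :: w' => Node v t1 (alter f t2 w') t3 t4
  | 3 :: w' => Node v t1 t2 (alter f t3 w') t4
  | 4 :: w' => Node v t1 t2 t3 (alter f t4 w')
  | _ => t
  end.

Fixpoint all_trie (A : Type) (f : seq nat -> A -> bool) (t : trie A) : bool :=
  if t is Node v t1 t2 t3 t4 then
    [&& if v is Some a then f [::] a else true,
        all_trie (fun w => f (1 :: w)) t1,
        all_trie (fun w => f (2 :: w)) t2,
        all_trie (fun w => f (3 :: w)) t3
      & all_trie (fun w => f (4 :: w)) t4]
  else true.

Lemma all_trieP (A : Type) (f : seq nat -> A -> bool) t w a :
  all_trie f t -> find t w = Some a -> f w a.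
Proof.
elim: t f w => [|v t1 IH1 t2 IH2 t3 IH3 t4 IH4] //= f w.
case/and5P=> fv f1 f2 f3 f4; case: w => [eqv|[|[|[|[|[|x]]]]] w] //.
- by rewrite eqv in fv.
- exact: (IH1 (fun w => f (1 :: w))).
- exact: (IH2 (fun w => f (2 :: w))).
- exact: (IH3 (fun w => f (3 :: w))).
- exact: (IH4 (fun w => f (4 :: w))).
Qed.

(** * Computing the window bounds *)

Definition alphabet := [:: 1; 2; 3; 4].

(** One trie encodes both predicates of a window bound: its keys are the
    allowed windows, and the value tells whether a key may be the window of a
    whole piece. *)
Definition seen (t : trie bool) : pred (seq nat) := fun w => find t w != None.
Definition complete (t : trie bool) : pred (seq nat) :=
  fun w => find t w == Some true.

(** The windows obtained by putting a, a a, a a a, ... in front of q, as long as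
    they are allowed, each with its run length. *)
Fixpoint run_windows (l : nat) (S : pred (seq nat)) (fuel a m : nat)
    (q : seq nat) : seq (nat * seq nat) :=
  if fuel is k.+1 then
    let q1 := take l (a :: q) in
    if S q1 then (m, q1) :: run_windows l S k a m.+1 q1 else [::]
  else [::].

(** Runs of length 4 are enumerated so that [closed_run] can verify that there
    are none. *)
Definition first_runs l S q : seq (nat * nat * seq nat) :=
  flatten [seq [seq (a, mq.1, mq.2) | mq <- run_windows l S 4 a 1 q]
          | a <- alphabet & ohead q != Some a].

Section Explore.

Variables (l : nat) (S F : pred (seq nat)) (l' : nat).

(** The relation of [transfer] as a trie: the value at q lists the w related
    to q. *)
Definition related (P : trie (seq (seq nat))) : rel (seq nat) :=
  fun q w => w \in odflt [::] (find P q).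

Definition record (fin : bool) (w : seq nat) (t : trie bool) : trie bool :=
  alter (fun v => fin || odflt false v) t w.

(** The exploration collects a window bound and a relation, and keeps the list
    of the pairs that remain to be visited. Nothing is proved about it: its
    outcome is verified by [closed]. *)
Definition state : Type :=
  trie bool * trie (seq (seq nat)) * seq (seq nat * seq nat).

Definition visit_run (w : seq nat) (s : state) (r : nat * nat * seq nat) : state :=
  let: (t, P, new) := s in let: (a, m, q1) := r in
  let w1 := grow l' a w in let w2 := grow l' m w1 in
  let t := record false w2 (record false w1 t) in
  let t := if cut a w then record true w t else t in
  let t := if cut m w1 then record true w1 t else t in
  if related P q1 w2 then (t, P, new)
  else (t, alter (fun v => w2 :: odflt [::] v) P q1, (q1, w2) :: new).

Definition visit (s : state) (qw : seq nat * seq nat) : state :=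
  let: (t, P, new) := s in let: (q, w) := qw in
  let t := if F q then record true w t else t in
  foldl (visit_run w) (t, P, new) (first_runs l S q).

Fixpoint explore (fuel : nat) (s : state) : state :=
  if fuel is k.+1 then
    let: (t, P, new) := s in
    if new is [::] then s else explore k (foldl visit (t, P, [::]) new)
  else s.

(** Breadth-first search; 200 exceeds the number of rounds that occur. *)
Definition explored : state :=
  explore 200 (record false [::] Leaf,
               alter (fun _ => [:: [::]]) Leaf [::],
               [:: ([::], [::])]).

Definition closed_run (t : trie bool) (P : trie (seq (seq nat))) (w : seq nat)
    (r : nat * nat * seq nat) : bool :=
  let: (a, m, q1) := r in
  let w1 := grow l' a w in let w2 := grow l' m w1 in
  [&& m <= 3, cut a w ==> complete t w, seen t w1, cut m w1 ==> complete t w1,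
      seen t w2 & related P q1 w2].

(** The hypotheses of [transfer], for the relation P and the bound t. *)
Definition closed (t : trie bool) (P : trie (seq (seq nat))) : bool :=
  [&& related P [::] [::], seen t [::]
    & all_trie (fun q ws =>
        let rs := first_runs l S q in let fin := F q in
        all (fun w => (fin ==> complete t w) && all (closed_run t P w) rs) ws) P].

End Explore.

(** The initial language, with 4 in the role of the large letter. *)
Definition chunk (w : seq nat) : bool :=
  small w && sorted (fun x _ => x != 4) w.

(** The common elements, and the two transuranic ones of the letter 4. *)
Definition table : seq (seq nat) :=
  common_elements ++
  [:: letters 13112221133211322112211213322114; letters 312211322212221121123222114].

(** Nested conditionals rather than a disjunction, whose two sides would both be
    evaluated by the virtual machine, at an exponential cost. *)
Fixpoint settles (n : nat) (w : seq nat) : bool :=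
  if w \in table then true
  else if n is n'.+1 then all (settles n') (pieces (JHC w)) else false.

(** The windows of successive days have the lengths listed in ls. At the end all
    windows are shorter than the last length, hence are whole words. *)
Fixpoint chain (l : nat) (S F : pred (seq nat)) (ls : seq nat) (n : nat) : bool :=
  if ls is l' :: ls' then
    let: (t, P, _) := explored l S F l' in
    [&& 5 < l', closed l S F l' t P
      & if ls' is [::] then
          all_trie (fun w fin => (size w < l') && (if fin then settles n w else true)) t
        else chain l' (seen t) (complete t) ls' n]
  else false.

Definition nonempty (w : seq nat) : bool := w != [::].

(** Six letters is the least length that [cut_take] permits, and long windows in
    the first days, when few splits have occurred, would be too numerous. They
    are lengthened progressively once words split often; length 100 is beyond
    all the words that are left on the last day. *)
Definition windows := [:: 6; 6; 6; 6; 6; 6; 8; 10; 12; 14; 16; 18; 100].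

(** The computation on which the theorem rests. Since the window bounds also
    admit words that are not pieces of any image, the words left in the end are
    somewhat more numerous than needed, but they all settle. *)
Lemma chain_windows : chain 4 chunk nonempty windows 14.
Proof. by vm_compute. Qed.

(** * Correctness of the computation *)

Definition in_alphabet (S : pred (seq nat)) : Prop :=
  forall a w, S (a :: w) -> a \in alphabet.

Lemma seen_in_alphabet t : in_alphabet (seen t).
Proof.
by move=> a w; rewrite /seen; case: t => // v t1 t2 t3 t4; case: a => [|[|[|[|[|a]]]]].
Qed.

Lemma nseqS_cat (a : nat) j s : nseq j.+1 a ++ s = nseq j a ++ a :: s.
Proof. by elim: j => //= j ->. Qed.

Lemma run_windowsP l S fuel a m j s :
    j < fuel -> locally l S (nseq j.+1 a ++ s) ->
  (m + j, take l (nseq j.+1 a ++ s)) \in run_windows l S fuel a m (take l s).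
Proof.
elim: fuel j m s => // k IHk j m s ltjk locs.
rewrite [run_windows _ _ _.+1 _ _ _]/= take_cons_take.
have Sas : S (take l (a :: s)).
  by apply/locally_take/(@locally_suffix l S (nseq j a)); rewrite -nseqS_cat.
rewrite Sas inE; case: j ltjk locs => [|j] ltjk locs; first by rewrite addn0 eqxx.
by rewrite nseqS_cat in locs *; rewrite addnS -addSn IHk ?orbT.
Qed.

Lemma first_runsP l S a m s :
    0 < l -> in_alphabet S -> m < 4 -> ohead s != Some a ->
    locally l S (nseq m.+1 a ++ s) ->
  (a, m.+1, take l (nseq m.+1 a ++ s)) \in first_runs l S (take l s).
Proof.
move=> l0 alphS lt4m nsa locs; apply/flatten_mapP; exists a.
  rewrite mem_filter (_ : ohead (take l s) = ohead s) ?nsa /=; last first.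
    by case: l l0 {locs}; case: s {nsa}.
  by have := locally_take locs; case: l l0 {locs} => // l _ /alphS.
apply/mapP; exists (m.+1, take l (nseq m.+1 a ++ s)) => //.
by rewrite -add1n run_windowsP.
Qed.

Lemma closed_transfer l S F l' t P s p :
    0 < l -> in_alphabet S -> 5 < l' -> closed l S F l' t P ->
    admissible l S F s -> p \in pieces (JHC s) ->
  admissible l' (seen t) (complete t) p.
Proof.
move=> l0 alphS lt5l' /and3P[P0 t0 ct].
have closedP q w : related P q w ->
    (F q ==> complete t w) && all (closed_run l' t P w) (first_runs l S q).
  rewrite /related; case Pq: (find P q) => [ws|] //= wws.
  exact: (allP (all_trieP ct Pq)).
apply: (transfer lt5l' P0 t0) => [s1 w m a Pw nsa locs | q w Pw Fq]; last first.
  by have /andP[/implyP->] := closedP _ _ Pw.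
have /andP[_ /allP clw] := closedP _ _ Pw.
have lt3m : m < 3.
  rewrite ltnNge; apply/negP => le3m.
  have locs4 : locally l S (nseq 4 a ++ s1).
    by apply: (@locally_suffix l S (nseq (m - 3) a)); rewrite catA -nseqD addnS subnK.
  by have /andP[] := clw _ (first_runsP l0 alphS (isT : 3 < 4) nsa locs4).
have := clw _ (first_runsP l0 alphS (ltnW lt3m) nsa locs).
by case/and5P=> _ /implyP ? ? /implyP ? /andP[].
Qed.

(** * Decay of chunks *)

Definition listed (E : seq nat) : Prop := E \in table.

Lemma table_closed : all (fun E => all (mem table) (pieces (JHC E))) table.
Proof. by vm_compute. Qed.

(** Elements decay into elements, so a piece that has settled early may wait for
    the others. *)
Lemma table_decays n E : E \in table -> decays listed n E.
Proof.
elim: n E => [|n IHn] E tE.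
  exists [:: E]; split=> [D|i]; first by rewrite inE => /eqP->.
  by rewrite /= cats0.
by apply: decaysS => p /(allP (allP table_closed _ tE)); apply: IHn.
Qed.

Lemma settles_decays n w : settles n w -> decays listed n w.
Proof.
elim: n w => [|n IHn] w /=; case: ifP => [tw _|_] //; try exact: table_decays.
by move/allP => sp; apply: decaysS => p /sp /IHn.
Qed.

(** A longer word would have a suffix of size l, which is its own window. *)
Lemma locally_size l t s (f : seq nat -> bool -> bool) :
    all_trie (fun w fin => (size w < l) && f w fin) t -> locally l (seen t) s ->
  size s < l.
Proof.
move=> szt locs; rewrite ltnNge; apply/negP => le_l_s.
have := locs; rewrite -(cat_take_drop (size s - l) s) => /locally_suffix/locally_take.
have szd : size (drop (size s - l) s) = l by rewrite size_drop subKn.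
rewrite -{1}szd take_size /seen; case fd: (find t _) => [b|] // _.
by have /andP[] := all_trieP szt fd; rewrite szd ltnn.
Qed.

Lemma chain_decays l S F ls n w :
    0 < l -> in_alphabet S -> chain l S F ls n -> admissible l S F w ->
  decays listed (size ls + n) w.
Proof.
elim: ls l S F w => //= l' ls IHls l S F w l0 alphS.
case: (explored _ _ _ _) => [[t P] _] /and3P[lt5l' clP chls] admw.
apply: decaysS => p /(closed_transfer l0 alphS lt5l' clP admw) admp.
case: ls chls IHls => [szt _|l2 ls chls IHls]; last first.
  by apply: IHls chls admp; [apply: ltn_trans lt5l' | apply: seen_in_alphabet].
case/andP: admp => /(locally_size szt) szp.
rewrite (take_oversize (ltnW szp)) => /eqP fp.
by have /andP[_] := all_trieP szt fp; apply: settles_decays.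
Qed.

Lemma chunk_cat u v : chunk (u ++ v) -> chunk u /\ chunk v.
Proof.
rewrite /chunk /small all_cat => /andP[/andP[/andP[-> ->] sr] /cat_sorted2[-> ->]].
by rewrite (short_runs_prefix sr) (short_runs_suffix sr).
Qed.

Lemma chunk_locally l w : chunk w -> locally l chunk w.
Proof.
elim: w => [|a w IHw] cw /=; first by case: l.
rewrite IHw ?andbT; last by have [] := @chunk_cat [:: a] w cw.
by rewrite -(cat_take_drop l (a :: w)) in cw; case: (chunk_cat cw).
Qed.

Definition days := size windows + 14.

Lemma chunk_decays w : chunk w -> w != [::] -> decays listed days w.
Proof.
move=> cw w0.
have alph : in_alphabet chunk.
  by move=> a v /andP[/andP[/andP[]]]; case: a => [|[|[|[|[|a]]]]].
have adm : admissible 4 chunk nonempty w.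
  by rewrite /admissible chunk_locally //; case: w w0 {cw}.
exact: (chain_decays (ltn0Sn 3) alph chain_windows adm).
Qed.

(** * The elements are atoms *)

(** Each way of cutting E in two is refuted, by [splitsP], within k days. *)
Definition all_cuts_meet (k : nat) (E : seq nat) : bool :=
  all (fun i => has (fun j => ohead (iter j JHC (drop i E)) == Some (last 0 (take i E)))
                    (iota 0 k))
      (iota 1 (size E).-1).

Lemma atomP k E : is_string E -> all_cuts_meet k E -> atom E.
Proof.
move=> strE /allP meets; split=> // L R /andP[L0 _] /andP[R0 _] defE /splitsP.
move=> /(_ L0 R0) heads; have := meets (size L).
rewrite defE drop_size_cat // take_size_cat // size_cat mem_iota.
case: L R L0 R0 heads {defE} => // a L [|b R] // _ _ heads.
rewrite /= add1n !ltnS addnS ltnS leq_addr => /(_ isT)/hasP[j _].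
exact/negP.
Qed.

Lemma common_atom E : common E -> atom E.
Proof.
have /allP checked :
    all (fun E => is_string E && all_cuts_meet 9 E) common_elements by vm_compute.
by move=> /checked/andP[]; apply: atomP.
Qed.

Lemma transuranic_atom E : transuranic E -> atom E.
Proof.
(* the letter n.+4 is a constructor form, which evaluation can tell from 1, 2
   and 3 although n is a variable *)
case=> -[|[|[|[|n]]]] // _ [] ->; apply: (@atomP 9); by vm_compute.
Qed.

(** * Large letters *)

Definition cosmic (E : seq nat) : Prop := common E \/ transuranic E.

Lemma relabel_table n E : 3 < n -> E \in table -> cosmic (map (relabel n) E).
Proof.
move=> lt3n; rewrite mem_cat => /orP[cE|]; last first.
  by rewrite !inE => /orP[]/eqP->; right; exists n => //; [left | right].
have /allP no4 : all (fun E => 4 \notin E) common_elements by vm_compute.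
rewrite map_id_in => [|x xE]; first by left.
by rewrite /relabel; case: eqP xE (no4 E cE) => // -> ->.
Qed.

Lemma small_table E : E \in table -> small E.
Proof. by have /allP := (isT : all small table); apply. Qed.

Lemma decays_relabel k n w :
    3 < n -> small w -> decays listed k w ->
  decays cosmic k (map (relabel n) w).
Proof.
move=> lt3n sw [Es [tEs eqEs]]; exists [seq map (relabel n) E | E <- Es].
split=> [_ /mapP[E /tEs tE ->]|i]; first exact: relabel_table.
rewrite iter_JHC_relabel // eqEs map_flatten -!map_comp; congr flatten.
by apply/eq_in_map => E /tEs/small_table sE; rewrite /= iter_JHC_relabel.
Qed.

Definition isolated_large (w : seq nat) : bool :=
  sorted (fun x y => (3 < x) ==> (y <= 3)) w.

(** A run letter is followed by the length of the next run, which is at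
    most 3. *)
Lemma isolated_large_JHC w : short_runs w -> isolated_large (JHC w).
Proof.
rewrite /isolated_large; elim/runs_ind: w => // m a s nsa IHs sr.
have lt3m := short_runs_nseq sr; have {}IHs := IHs (short_runs_suffix sr).
rewrite JHC_nseq //= implybE -leqNgt lt3m /=.
case: (first_runP s) IHs sr {nsa} => // k b t ntb.
rewrite (JHC_nseq _ ntb) => IHs /short_runs_suffix/short_runs_nseq lt3k.
by rewrite [path _ _ _]/= lt3k implybT.
Qed.

(** All proper descendants begin with a run length, at most 3, so a word splits
    after its large letters. *)
Lemma ohead_iter_JHC n w x :
  short_runs w -> ohead w != Some x -> 3 < x -> ohead (iter n JHC w) != Some x.
Proof.
move=> sr nwx lt3x; case: n => //= n.
have {sr} : short_runs (iter n JHC w) by case: n => //= n; apply: short_runs_JHC.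
case: (first_runP (iter n JHC w)) => // m a s nsa /short_runs_nseq lt3m.
by rewrite JHC_nseq //=; apply: contraTneq lt3x => -[<-]; rewrite -leqNgt.
Qed.

Lemma isolated_large_decays w :
    is_string w -> short_runs w -> isolated_large w -> decays cosmic days w.
Proof.
have [k] := ubnP (size w); elim: k w => // k IHk w ltwk /andP[w0 wpos] srw isow.
have small_lt3 u : all (leq 1) u -> ~~ has (fun x => 3 < x) u ->
    all (fun x => 0 < x <= 4) u && sorted (fun x _ => x != 4) u.
  move=> /allP upos /hasPn ule3; apply/andP; split.
    by apply/allP => x xu; rewrite upos // leqW // leqNgt ule3.
  case: u {upos} ule3 => //= a u; elim: u a => //= b u IHu a ule3.
  rewrite IHu => [|x xu]; last by rewrite ule3 // inE xu orbT.
  by rewrite andbT; apply: contraTneq (ule3 a (mem_head _ _)) => ->.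
have [lw|] := boolP (has (fun x => 3 < x) w); last first.
  move=> /(small_lt3 _ wpos)/andP[w4 w_4].
  have cw : chunk w by rewrite /chunk /small w4 srw w_4.
  have -> : w = map (relabel 4) w.
    by rewrite map_id_in // => x _; rewrite /relabel; case: eqP.
  by apply: decays_relabel => //; [case/andP: cw | apply: chunk_decays].
(* n is the first large letter, and u what precedes it *)
move: w0 wpos srw isow ltwk; case/split_find: lw => n u R lt3n ule3 _ wpos srw isow ltwk.
have decL : decays cosmic days (rcons u n).
  have -> : rcons u n = map (relabel n) (rcons u 4).
    rewrite map_rcons map_id_in // => x xu; rewrite /relabel; case: eqP => // def_x.
    by have /hasPn/(_ x xu) := ule3; rewrite def_x.
  have upos : all (leq 1) u.
    by move: wpos; rewrite all_cat all_rcons -andbA => /and3P[].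
  have /andP[u4 u_4] := small_lt3 _ upos ule3.
  have c4 : chunk (rcons u 4).
    rewrite /chunk /small all_rcons u4 /= short_runs_rcons /=.
    - case: u {wpos srw isow ltwk upos u4} ule3 u_4 => //= a u; rewrite rcons_path => ule3 ->.
      rewrite negb_or in ule3; case/andP: ule3 => lea /hasPn leu.
      have := mem_last a u; rewrite inE => /predU1P[->|/leu].
        by apply: contraNneq lea => ->.
      by apply: contraNneq => ->.
    - by apply/allP => x xu; rewrite ltnS leqNgt; have /hasPn/(_ x xu) := ule3.
    by move: srw; rewrite -cats1 => /short_runs_prefix/short_runs_prefix.
  by apply: decays_relabel => //; [case/andP: c4 | apply: chunk_decays => //; case: (u)].
have [->|R0] := eqVneq R [::]; first by rewrite cats0.
apply: decays_splits (decL) _.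
  apply/splitsP => // [|i]; first by case: (u).
  rewrite last_rcons ohead_iter_JHC ?(short_runs_suffix srw) //.
  move: isow; rewrite /isolated_large; case: R R0 {wpos srw ltwk} => // b R _.
  rewrite cat_rcons sorted_cat_cons /= lt3n => /and3P[_ le3b _].
  by apply: contraTneq lt3n => -[<-]; rewrite -leqNgt.
apply: IHk.
- apply: leq_trans (_ : _ < size (rcons u n ++ R)) _ => //.
  by rewrite size_cat size_rcons addSn ltnS leq_addl.
- by rewrite /is_string R0; move: wpos; rewrite all_cat => /andP[].
- exact: short_runs_suffix srw.
by case/cat_sorted2: isow.
Qed.

(** * The cosmological theorem *)

Theorem mainTheorem1 :
  exists N : nat, forall w : seq nat, is_string w ->
    exists k : nat, k <= N /\
      compound (fun E => common E \/ transuranic E) (iter k JHC w).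
Proof.
(* the first day bounds the runs by 3, the second isolates the large letters *)
exists (2 + days) => w strw; exists (2 + days); split=> //.
rewrite addnC iterD; have strv := is_string_JHC (is_string_JHC strw).
have srw := short_runs_JHC w.
have [Es [cosEs eqEs]] := isolated_large_decays strv
  (short_runs_JHC _) (isolated_large_JHC srw).
exists Es; split=> //; split=> [|E /cosEs[]|n].
- apply/eqP => Es0; have := eqEs 0; rewrite Es0 addn0 => /eqP.
  by rewrite iter_JHC_eq0; case/andP: strv => /negPf->.
- exact: common_atom.
- exact: transuranic_atom.
by rewrite -iterD addnC; apply: eqEs.
Qed.
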